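(* Let $X$ be an infinite set. If $S$ is an $\aleph_0$-transitive subsemigroup of $\mathcal H_X$, then $\omega_S^l$ is not finitely generated. In particular, the universal left congruence on each of the following semigroups is not finitely generated: $\mathrm{Sym}_X$; $\mathcal F_X$; $\mathrm{Inj}_X$; $\mathrm{BL}_{X,p}$ where $\aleph_0\leq p\leq|X|$; $\mathrm{BL}_X^1$; $\mathrm{Sym}_X\cup \mathrm{BL}_X$; $\mathrm{DBL}_{X,q}$ where $\aleph_0\leq q<|X|$; $\mathcal H_X$; and $\mathcal K_X$.
   Context: Maps are written on the right and composed from left to right. $\mathcal T_X$ is the monoid of all maps $X\to X$, with identity $1_X$. Subsemigroups of $\mathcal T_X$: $\mathcal H_X=\{\alpha\in\mathcal T_X : |Y\alpha|=|X|\text{ for all }Y\subseteq X\text{ with }|Y|=|X|\}$; $\mathcal K_X=\{\alpha\in\mathcal H_X : |X\setminus\operatorname{im}\alpha|<|X|\}$; $\mathrm{Sym}_X$, all bijections; $\mathrm{Inj}_X$, all injections; $\mathrm{Surj}_X$, all surjections; $\mathcal F_X=\{\alpha\in\mathcal T_X: |x\alpha^{-1}|<\infty\text{ for all }x\in X\}$; for an infinite cardinal $q\leq|X|$, $\mathrm{BL}_{X,q}=\{\alpha\in\mathrm{Inj}_X:|X\setminus\operatorname{im}\alpha|=q\}$ and $\mathrm{DBL}_{X,q}=\{\alpha\in\mathrm{Surj}_X:|x\alpha^{-1}|=q\text{ for all }x\in X\}$; $\mathrm{BL}_X=\mathrm{BL}_{X,|X|}$ and $\mathrm{BL}_X^1=\mathrm{BL}_X\cup\{1_X\}$.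 For a cardinal $\kappa\leq|X|$, a subsemigroup $S$ of $\mathcal T_X$ is $\kappa$-transitive if for every partial bijection $\lambda$ on $X$ (injective partial map $X\to X$) with $|\operatorname{dom}\lambda|\leq\kappa$ and $|X\setminus\operatorname{dom}\lambda|=|X\setminus\operatorname{im}\lambda|=|X|$ there is some $\theta\in S$ with $\theta|_{\operatorname{dom}\lambda}=\lambda$. A left congruence on a semigroup $S$ is an equivalence relation $\rho$ such that $(a,b)\in\rho$ implies $(sa,sb)\in\rho$ for all $s\in S$. The universal left congruence $\omega_S^l$ is $S\times S$ viewed as a left congruence; it is finitely generated if there is a finite $U\subseteq S\times S$ such that $S\times S$ is the smallest left congruence on $S$ containing $U$. *)

(* Defs.v *)
From mathcomp Require Import all_boot.
From mathcomp Require Import boolp classical_sets functions cardinality.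

Set Implicit Arguments.
Unset Strict Implicit.
Unset Printing Implicit Defensive.

Local Open Scope classical_set_scope.
Local Open Scope card_scope.

(* A cardinal is represented by any set of that cardinality, on any type. *)
Definition card_lt (T U : Type) (A : set T) (B : set U) : Prop :=
  (A #<= B) /\ ~ (A #= B).

(* Maps act on the right: the image of x under a b is (x a) b. *)
Definition tmul (X : Type) (a b : X -> X) : X -> X := b \o a.

Definition subsemigroup (X : Type) (S : set (X -> X)) : Prop :=
  forall a b, S a -> S b -> S (tmul a b).

Definition HX (X : Type) : set (X -> X) :=
  [set a | forall Y : set X, Y #= [set: X] -> (a @` Y) #= [set: X]].

Definition KX (X : Type) : set (X -> X) :=
  [set a | HX a /\ card_lt (~` range a) [set: X]].

Definition SymX (X : Type) : set (X -> X) := [set a | bijective a].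

Definition InjX (X : Type) : set (X -> X) := [set a | injective a].

Definition SurjX (X : Type) : set (X -> X) := [set a | range a = [set: X]].

Definition FX (X : Type) : set (X -> X) :=
  [set a | forall x, finite_set (a @^-1` [set x])].

Definition BLq (X U : Type) (Q : set U) : set (X -> X) :=
  [set a | InjX a /\ (~` range a) #= Q].

Definition DBLq (X U : Type) (Q : set U) : set (X -> X) :=
  [set a | SurjX a /\ forall x, (a @^-1` [set x]) #= Q].

Definition BL (X : Type) : set (X -> X) := @BLq X X [set: X].

Definition BL1 (X : Type) : set (X -> X) := @BL X `|` [set id].

(* A partial bijection is given by its domain D and a total map l injective  *)
(* on D; the values of l outside D are irrelevant.                           *)
Definition transitive_upto (X U : Type) (K : set U) (S : set (X -> X)) : Prop :=
  forall (D : set X) (l : X -> X),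
    set_inj D l -> D #<= K ->
    (~` D) #= [set: X] -> (~` (l @` D)) #= [set: X] ->
    exists2 t, S t & forall x, D x -> t x = l x.

Definition left_congruence (X : Type) (S : set (X -> X))
    (rho : set ((X -> X) * (X -> X))) : Prop :=
  [/\ rho `<=` S `*` S,
      forall a, S a -> rho (a, a),
      forall a b, rho (a, b) -> rho (b, a),
      forall a b c, rho (a, b) -> rho (b, c) -> rho (a, c) &
      forall s a b, S s -> rho (a, b) -> rho (tmul s a, tmul s b)].

Definition universal_left_congruence (X : Type) (S : set (X -> X)) :
  set ((X -> X) * (X -> X)) := S `*` S.

(* When S is a subsemigroup, S `*` S is a left congruence containing U, so   *)
(* [smallest] is an intersection over a nonempty family and is itself a left *)
(* congruence on S.                                                          *)
Definition left_congruence_fg (X : Type) (S : set (X -> X))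
    (rho : set ((X -> X) * (X -> X))) : Prop :=
  exists U : set ((X -> X) * (X -> X)),
    [/\ finite_set U, U `<=` S `*` S & smallest (left_congruence S) U = rho].

(* Main.v *)
Require Import Defs.
From mathcomp Require Import all_boot.
From mathcomp Require Import boolp classical_sets functions cardinality.

Local Open Scope classical_set_scope.
Local Open Scope card_scope.

(** For finitely many pairs (a, b) of maps, join the points z a and z b of X
by an edge, for every pair and every z.  Replacing s a by s b moves the image
of each point along an edge, so two maps that are identified by the left
congruence generated by the pairs send every x to two points joined by a walk,
of a length that does not depend on x ([smallest_walk_congruence]).  The
number of generators does not bound the degrees of this graph, but on
[HX] the preimage of a set of fewer than |X| points has fewer than |X| points
([HX_preimage_gt]); hence fewer than |X| points are reached from a given point
by walks of a given length ([walk_gt]).  One can therefore choose points p_n and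
q_n with no walk of length n between them, all the p_n distinct, all the q_n
distinct, leaving |X| points of X untouched.  An aleph_0-transitive
semigroup contains a map fixing every p_n and a map sending p_n to q_n for
every n, and no common length serves these two maps
([not_left_congruence_fg]).

For the named semigroups, a partial bijection whose domain and image have
complements of size |X| extends to an injection missing a set of any
prescribed size P <= |X| ([BLq_transitive]; the permutations are the case of
the empty set), and to a surjection all of whose fibres have the prescribed
infinite size Q <= |X|, by mapping the complement of the domain onto X like the
projection of X * Q ([DBLq_transitive]).  A semigroup containing all
permutations inherits their transitivity.  Membership in [HX] is clear for
injections, and otherwise comes from bounding a set by the size of its image
times that of the fibres.

All the counting rests on two facts of cardinal arithmetic proved with Zorn's
lemma: cardinals are comparable ([card_le_total]), and S * S has the size of S
for infinite S ([card_square_le]). *)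

(** * Comparing cardinals through relations and functions *)

(** This covers in one form injections, choices of representatives and
transposed graphs, with no default value to supply when one side may be
empty. *)
Lemma card_le_rel {T U : Type} (A : set T) (B : set U) (R : T -> U -> Prop) :
  (forall x, A x -> exists2 y, B y & R x y) ->
  (forall x x' y, A x -> A x' -> R x y -> R x' y -> x = x') ->
  A #<= B.
Proof.
move=> Rtot Rinj.
have [[x0 Ax0]|A0] := pselect (A !=set0); last first.
  have -> : A = set0 by apply/seteqP; split=> // x Ax; case: A0; exists x.
  exact: card_ge0.
have [y0 _ _] := Rtot x0 Ax0.
have /choice[f fP] : forall x, exists y, A x -> B y /\ R x y.
  move=> x; have [/Rtot[y By Rxy]|nAx] := pselect (A x); first by exists y.
  by exists y0.
have : $|{injfun A >-> B}|.
  apply/injfunPex; exists f; first by move=> x /fP[].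
  move=> x x' /set_mem Ax /set_mem Ax' fE; have [_ Rx] := fP x Ax.
  by have [_] := fP x' Ax'; rewrite -fE; exact: Rinj.
by case=> g; exact: inj_card_le g.
Qed.

Lemma card_eq_fun {T U : Type} (A : set T) (B : set U) (u0 : U) :
  A #= B -> exists f : T -> U,
    [/\ set_fun A B f, forall x y, A x -> A y -> f x = f y -> x = y &
        set_surj A B f].
Proof.
elim/Ppointed: U => U in B u0 *; first by case: (no u0).
move=> /card_set_bijP[f [fAB fI fS]]; exists f; split=> // x y Ax Ay.
by apply: fI; exact: mem_set.
Qed.

Lemma card_le_fun {T U : Type} (A : set T) (B : set U) (u0 : U) :
  A #<= B -> exists2 f : T -> U,
    set_fun A B f & forall x y, A x -> A y -> f x = f y -> x = y.
Proof.
elim/Ppointed: U => U in B u0 *; first by case: (no u0).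
move=> /pcard_leP/injfunPex[f fAB fI]; exists f => // x y Ax Ay.
by apply: fI; exact: mem_set.
Qed.

Lemma card_leX {T T' U U' : Type}
    (A : set T) (B : set U) (A' : set T') (B' : set U') :
  A #<= A' -> B #<= B' -> A `*` B #<= A' `*` B'.
Proof.
move=> AA' BB'.
have [[[a b] [Aa Bb]]|AB0] := pselect (A `*` B !=set0); last first.
  have -> : A `*` B = set0 by apply/seteqP; split=> // p ABp; case: AB0; exists p.
  exact: card_ge0.
have [a' _ _] : exists2 a', A' a' & True.
  have [//|A0] := pselect (exists2 a', A' a' & True).
  have A'0 : A' = set0 by apply/seteqP; split=> // x A'x; case: A0; exists x.
  by move: AA'; rewrite A'0 => /card_le0P A00; rewrite A00 in Aa.
have [b' _ _] : exists2 b', B' b' & True.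
  have [//|B0] := pselect (exists2 b', B' b' & True).
  have B'0 : B' = set0 by apply/seteqP; split=> // x B'x; case: B0; exists x.
  by move: BB'; rewrite B'0 => /card_le0P B00; rewrite B00 in Bb.
have [f fA fI] := card_le_fun A A' a' AA'.
have [g gB gI] := card_le_fun B B' b' BB'.
apply: (card_le_rel _ _ (fun p q => q = (f p.1, g p.2))).
  by move=> [x y] [/= Ax By]; exists (f x, g y) => //; split; [exact: fA|exact: gB].
move=> [x y] [x' y'] _ [/= Ax By] [/= Ax' By'] -> [fE gE].
by rewrite (fI x x' Ax Ax' fE)
  (gI y y' By By' gE).
Qed.

(** * Comparability of cardinals *)

(** The single equivalence makes [G] both functional and injective, so that
the notion is self-dual and [G] can be read as a partial injection in either
direction. *)
Definition injective_graph {T U : Type} (G : set (T * U)) : Prop :=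
  forall p q, G p -> G q -> (p.1 = q.1 <-> p.2 = q.2).

Lemma injective_graph_bigcup {T U : Type} (F : set (set (T * U))) :
  total_on F subset -> (forall G, F G -> injective_graph G) ->
  injective_graph (\bigcup_(G in F) G).
Proof.
move=> Ftot Finj p q [G FG Gp] [H FH Hq].
have [GH|HG] := Ftot _ _ FG FH.
  exact: (Finj H FH p q (GH _ Gp) Hq).
exact: (Finj G FG p q Gp (HG _ Hq)).
Qed.

(** A maximal partial injection from [A] to [B] is total or onto, for
otherwise one more pair could be added. *)
Lemma card_le_total {T U : Type} (A : set T) (B : set U) : A #<= B \/ B #<= A.
Proof.
pose P (G : set (T * U)) := injective_graph G /\ G `<=` A `*` B.
have [|G [[Ginj GAB] Gmax]] := @Zorn_bigcup _ P.
  move=> F FP Ftot; split; last by move=> p [G /FP[_ GAB] /GAB].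
  by apply: injective_graph_bigcup => // G /FP[].
have [Gtot|/existsNP[x /not_implyP[Ax xG]]] :=
    pselect (forall x, A x -> exists y, G (x, y)).
  left; apply: (card_le_rel _ _ (fun x y => G (x, y))) => [x /Gtot[y Gxy]|].
    by exists y => //; have [] := GAB _ Gxy.
  by move=> x x' y _ _ Gxy Gx'y; have [_] := Ginj _ _ Gxy Gx'y; apply.
have [Gsurj|/existsNP[y /not_implyP[By yG]]] :=
    pselect (forall y, B y -> exists x, G (x, y)).
  right; apply: (card_le_rel _ _ (fun y x => G (x, y))) => [y /Gsurj[x' Gxy]|].
    by exists x' => //; have [] := GAB _ Gxy.
  by move=> y y' x' _ _ Gxy Gxy'; have [+ _] := Ginj _ _ Gxy Gxy'; apply.
(* Neither side is exhausted, so the pair (x, y) extends the maximal graph. *)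
have [] := Gmax (G `|` [set (x, y)]).
  split; last by move=> GG; apply: xG; exists y; apply: GG; right.
  by left.
split; last by move=> p [/GAB//|->].
move=> p q [Gp|->] [Gq|->] //=.
- exact: Ginj.
- split=> E; [case: xG; exists p.2|case: yG; exists p.1];
  by rewrite -E -surjective_pairing.
- split=> E; [case: xG; exists q.2|case: yG; exists q.1];
  by rewrite E -surjective_pairing.
Qed.

(** * The square of an infinite cardinal *)

(** Two points of [S] tag the two copies of [S] inside its square.  The
hypothesis on the square is kept because the lemma serves in the proof that it
always holds. *)
Lemma card_leU_square {T U : Type} (A B : set T) (S : set U) :
  infinite_set S -> S `*` S #<= S -> A #<= S -> B #<= S -> A `|` B #<= S.
Proof.
move=> Sinf SS AS BS.
have [s0 Ss0] := infinite_setN0 Sinf.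
have [s1 [Ss1 s10]] : S `\` [set s0] !=set0.
  exact/infinite_setN0/infinite_setD/finite_set1.
have [f fA fI] := card_le_fun A S s0 AS.
have [g gB gI] := card_le_fun B S s0 BS.
apply: card_le_trans SS.
apply: (card_le_rel _ _ (fun x p =>
  A x /\ p = (s0, f x) \/ (~ A x /\ B x) /\ p = (s1, g x))).
  move=> x ABx; have [Ax|nAx] := pselect (A x).
    by exists (s0, f x); [split=> //; exact: fA|left].
  have Bx : B x by case: ABx.
  by exists (s1, g x); [split=> //; exact: gB|right].
move=> x x' p _ _ [[Ax ->]|[[_ Bx] ->]] [[Ax' [E]]|[[_ Bx'] [E]]].
- exact: (fI x x' Ax Ax').
- by case: s10.
- by case: s10.
- exact: (gI x x' Bx Bx').
Qed.

(** Reading the carrier B of an injection of B * B into B off the diagonal of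
its graph makes the carrier of a union of graphs the union of the carriers. *)
Definition square_carrier {T : Type} (G : set (T * T * T)) : set T :=
  [set x | exists z, G (x, x, z)].

Definition square_injection {T : Type} (G : set (T * T * T)) : Prop :=
  [/\ injective_graph G,
      forall x y z, G (x, y, z) ->
        [/\ square_carrier G x, square_carrier G y & square_carrier G z] &
      forall x y, square_carrier G x -> square_carrier G y -> exists z, G (x, y, z)].

Lemma square_injection_card {T : Type} (G : set (T * T * T)) :
  square_injection G -> square_carrier G `*` square_carrier G #<= square_carrier G.
Proof.
move=> [Ginj GD Gtot]; apply: (card_le_rel _ _ (fun p z => G (p, z))).
  move=> [x y] [/= Dx Dy]; have [z Gz] := Gtot x y Dx Dy.
  by exists z => //; have [] := GD _ _ _ Gz.
by move=> p q z _ _ Gp Gq; have [_] := Ginj _ _ Gp Gq; apply.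
Qed.

Lemma square_injection_bigcup {T : Type} (F : set (set (T * T * T))) :
  total_on F subset -> (forall G, F G -> square_injection G) ->
  square_injection (\bigcup_(G in F) G).
Proof.
move=> Ftot FP; split.
- by apply: injective_graph_bigcup => // G /FP[].
- move=> x y z [G FG Gxyz]; have [_ GD _] := FP _ FG.
  have [[u xu] [v yv] [w zw]] := GD _ _ _ Gxyz.
  by split; [exists u|exists v|exists w]; exists G.
- move=> x y [u [G FG Gu]] [v [H FH Hv]].
  have [GH|HG] := Ftot _ _ FG FH.
    have [_ _ Htot] := FP _ FH.
    have [||z Hz] := Htot x y; [by exists u; exact: GH|by exists v|].
    by exists z, H.
  have [_ _ Gtot] := FP _ FG.
  have [||z Gz] := Gtot x y; [by exists u|by exists v; exact: HG|].
  by exists z, G.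
Qed.

Lemma square_injection_nat {T : Type} : infinite_set [set: T] ->
  exists2 G : set (T * T * T), square_injection G & infinite_set (square_carrier G).
Proof.
move=> Tinf; have [t0 _] := infinite_setN0 Tinf.
have /(card_le_fun _ _ t0)[f _ fI] := (infiniteP _).1 Tinf.
have [|g _ gI] := card_le_fun [set: nat * nat] [set: nat] 0%N.
  by have /card_eqPle[] := card_nat2.
pose G := [set p : T * T * T | exists m n, p = (f m, f n, f (g (m, n)))].
have GE : square_carrier G = range f.
  apply/seteqP; split=> [x [z [m [n [-> _ _]]]]|_ [n _ <-]]; first by exists m.
  by exists (f (g (n, n))), n, n.
exists G; last first.
  rewrite GE; apply/infiniteP; apply: (card_le_rel _ _ (fun n x => x = f n)).
    by move=> n _; exists (f n).
  by move=> n m x _ _ -> /(fI _ _ I I).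
rewrite /square_injection GE; split.
- move=> _ _ [m [n ->]] [m' [n' ->]] /=; split=> [[mm nn]|].
    by rewrite (fI _ _ I I mm) (fI _ _ I I nn).
  by move=> /(fI _ _ I I)/(gI _ _ I I)[-> ->].
- by move=> x y z [m [n [-> -> ->]]]; split; [exists m|exists n|exists (g (m, n))].
- by move=> _ _ [m _ <-] [n _ <-]; exists (f (g (m, n))), m, n.
Qed.

(** If the complement of the carrier B contains a copy C of B, then, writing
D for the union of B and C, the pairs in D * D outside B * B can be injected
into C, because D * D has size at most |B| = |C|.  The new values avoid the old
ones since C and B are disjoint. *)
Lemma square_injection_extend {T : Type} (G : set (T * T * T)) :
  square_injection G -> infinite_set (square_carrier G) ->
  square_carrier G #<= ~` square_carrier G ->
  exists2 G', G `<` G' & square_injection G'.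
Proof.
set B := square_carrier G => GS Binf BC.
have [Ginj GD Gtot] := GS; have BB : B `*` B #<= B := square_injection_card _ GS.
have [b0 Bb0] := infinite_setN0 Binf.
have [f fBC fI] := card_le_fun _ _ b0 BC.
pose C := f @` B; pose D := B `|` C.
have CnB x : C x -> ~ B x by case=> y By <-; exact: fBC.
have DC : D `*` D #<= C.
  have DB : D #<= B by apply: card_leU_square => //; exact: card_image_le.
  apply: card_le_trans (card_leX _ _ _ _ DB DB) _; apply: card_le_trans BB _.
  apply: (card_le_rel _ _ (fun x y => y = f x)) => [x Bx|x y _ Bx By -> /fI].
    by exists (f x) => //; exists x.
  by apply.
have [g gC gI] := card_le_fun _ _ b0 DC.
pose N := [set p : T * T * T |
  [/\ D p.1.1, D p.1.2, ~ (B p.1.1 /\ B p.1.2) & p.2 = g p.1]].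
have NC p : N p -> C p.2 by case=> ? ? _ ->; exact: gC.
have GB p : G p -> [/\ B p.1.1, B p.1.2 & B p.2].
  by case: p => [[x y] z]; exact: GD.
have GNE : square_carrier (G `|` N) = D.
  apply/seteqP; split=> [x [z [Gx|[]//]]|x Dx]; first by left; exists z.
  have [[z Gz]|nBx] := pselect (B x); first by exists z; left.
  by exists (g (x, x)); right; split=> // -[].
have Cf x : B x -> C (f x) by exists x.
exists (G `|` N).
  split; first by left.
  move=> GN.
  have : G (f b0, f b0, g (f b0, f b0)).
    apply: GN; right; split=> //=; [right; exact: Cf|right; exact: Cf|].
    by case=> /(CnB _ (Cf _ Bb0)).
  by case/GB => /(CnB _ (Cf _ Bb0)).
split.
- move=> p q [Gp|Np] [Gq|Nq].
  + exact: Ginj.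
  + have [Bp1 Bp2 Bp] := GB _ Gp; split=> E.
      by case: Nq => _ _ []; rewrite -E.
    by case: (CnB _ (NC _ Nq)); rewrite -E.
  + have [Bq1 Bq2 Bq] := GB _ Gq; split=> E.
      by case: Np => _ _ []; rewrite E.
    by case: (CnB _ (NC _ Np)); rewrite E.
  + case: Np Nq => Dp1 Dp2 _ -> [Dq1 Dq2 _ ->]; split=> [->//|].
    by apply: gI.
- move=> x y z; rewrite GNE => -[/GD[Bx By Bz]|]; first by split; left.
  by move=> /[dup] Nz [Dx Dy _ _]; split=> //; right; exact: NC _ Nz.
- move=> x y; rewrite GNE => Dx Dy.
  have [[Bx By]|nB] := pselect (B x /\ B y).
    by have [z Gz] := Gtot _ _ Bx By; exists z; left.
  by exists (g (x, y)); right.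
Qed.

(** The carrier B of a maximal injection of an infinite square into itself has
a complement of size at most |B|, by [square_injection_extend]; so T is a union
of two sets of size at most |B| and has size |B|.  This last step needs B to be
infinite, which is why the maximality is taken among infinite carriers. *)
Lemma card_square_leT {T : Type} :
  infinite_set [set: T] -> [set: T] `*` [set: T] #<= [set: T].
Proof.
move=> Tinf.
pose P (G : set (T * T * T)) :=
  square_injection G /\ (G !=set0 -> infinite_set (square_carrier G)).
have [|G [[GS Ginf] Gmax]] := @Zorn_bigcup _ P.
  move=> F FP Ftot; split.
    by apply: square_injection_bigcup => // G /FP[].
  move=> [p [G FG Gp]]; have [_ /(_ (ex_intro _ p Gp))] := FP _ FG.
  by apply: sub_infinite_set => x [z Gz]; exists z, G.
set B := square_carrier G in Ginf.
(* The empty graph satisfies [P] vacuously, as the union of the empty chain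
   must; it is not maximal, because a countable subset carries a nonempty one. *)
have Binf : infinite_set B.
  have [/Ginf//|G0] := pselect (G !=set0).
  have [H HS Hinf] := square_injection_nat Tinf.
  have [] := Gmax H; last by split.
  split=> [p Gp|HG]; first by case: G0; exists p.
  by have [x [z /HG Gz]] := infinite_setN0 Hinf; case: G0; exists (x, x, z).
have BB := square_injection_card _ GS; rewrite -/B in BB.
have [CB|BC] := card_le_total (~` B) B; last first.
  have [H [GH nHG] HS] := square_injection_extend _ GS Binf BC.
  have [] := Gmax H; first by split.
  split=> // _; apply: sub_infinite_set Binf => x [z Gz].
  by exists z; exact: GH.
have TB : [set: T] #<= B.
  rewrite -(setUv B); exact: card_leU_square.
apply: card_le_trans (card_leX _ _ _ _ TB TB) _.
exact: card_le_trans BB (card_leT _).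
Qed.

Lemma card_square_le {T : Type} (S : set T) : infinite_set S -> S `*` S #<= S.
Proof.
have /card_eqPle[SS' S'S] := card_setT S => Sinf.
apply: card_le_trans (card_leX _ _ _ _ S'S S'S) _.
apply: card_le_trans SS'; apply: card_square_leT.
by rewrite (eq_finite_set (card_setT S)).
Qed.

Lemma card_leU_infinite {T U : Type} (A B : set T) (S : set U) :
  infinite_set S -> A #<= S -> B #<= S -> A `|` B #<= S.
Proof. by move=> Sinf; apply: card_leU_square => //; exact: card_square_le. Qed.

Lemma card_leX_infinite {T U V : Type} (A : set T) (B : set U) (S : set V) :
  infinite_set S -> A #<= S -> B #<= S -> A `*` B #<= S.
Proof.
move=> Sinf AS BS; apply: card_le_trans (card_leX _ _ _ _ AS BS) _.
exact: card_square_le.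
Qed.

(** * Sets of fewer than |S| elements *)

(** By comparability, the negation of S <= A says |A| < |S|. *)
Lemma card_gtU_infinite {T U : Type} (A B : set T) (S : set U) :
  infinite_set S -> ~ (S #<= A) -> ~ (S #<= B) -> ~ (S #<= A `|` B).
Proof.
move=> Sinf SA SB SAB.
wlog AB : A B SA SB SAB / A #<= B.
  move=> W; have [/W|/W] := card_le_total A B; first exact.
  by rewrite setUC in SAB; exact.
have [Bfin|Binf] := pselect (finite_set B).
  apply: Sinf; apply: card_le_finite SAB _; rewrite finite_setU; split=> //.
  exact: card_le_finite AB Bfin.
by apply: SB; apply: card_le_trans SAB _; exact: card_leU_infinite.
Qed.

Lemma card_gtX_infinite {T U V : Type} (A : set T) (B : set U) (S : set V) :
  infinite_set S -> ~ (S #<= A) -> ~ (S #<= B) -> ~ (S #<= A `*` B).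
Proof.
move=> Sinf SA SB SAB.
have [Afin|Ainf] := pselect (finite_set A); last first.
  have [AB|BA] := card_le_total A B.
  + apply: SB; apply: card_le_trans SAB _; apply: card_leX_infinite => //.
    by move=> Bfin; apply: Ainf; exact: card_le_finite AB Bfin.
  + by apply: SA; apply: card_le_trans SAB _; exact: card_leX_infinite.
have [Bfin|Binf] := pselect (finite_set B).
  by apply: Sinf; apply: card_le_finite SAB _; exact: finite_setX.
apply: SB; apply: card_le_trans SAB _; apply: card_leX_infinite => //.
apply: card_le_trans ((infiniteP _).1 Binf); exact: finite_set_countable.
Qed.

Lemma card_gt_bigcup_finite {I T U : Type} (D : set I) (F : I -> set T) (S : set U) :
  infinite_set S -> finite_set D -> (forall i, D i -> ~ (S #<= F i)) ->
  ~ (S #<= \bigcup_(i in D) F i).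
Proof.
move=> Sinf [n]; elim: n D => [|n IH] D Dn SF.
  have -> : D = set0 by apply/eqP; rewrite -(card_eq0 (U := nat)) -II0.
  rewrite bigcup_set0 => /card_le0P S0; apply: Sinf; rewrite S0.
  exact: finite_set0.
have [x Dx DxI] := eq_cardSP _ _ Dn.
rewrite -(setD1K Dx) bigcup_setU1; apply: card_gtU_infinite => //; first exact: SF.
by apply: IH => // i [Di _]; exact: SF.
Qed.

(** * Walks along the generators of a left congruence *)

(** A preimage of size |X| would be mapped by [a] onto a set of size |X|
inside [B]. *)
Lemma HX_preimage_gt {X : Type} (a : X -> X) (B : set X) :
  HX a -> ~ ([set: X] #<= B) -> ~ ([set: X] #<= a @^-1` B).
Proof.
move=> aH XB XaB; apply: XB.
have /card_eqPle[_] : a @` (a @^-1` B) #= [set: X].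
  by apply: aH; apply: Cantor_Bernstein => //; exact: card_leT.
by move=> /card_le_trans; apply; apply: subset_card_le => _ [x Bx <-].
Qed.

Section Walks.
Context {X : Type} (U : set ((X -> X) * (X -> X))).

(** The edges are taken in both directions, which makes the relation of being
joined by a walk of length n symmetric. *)
Definition adjacent (x y : X) : Prop :=
  exists2 p, U p & exists z,
    (x = p.1 z /\ y = p.2 z) \/ (x = p.2 z /\ y = p.1 z).

Fixpoint walk (n : nat) (x y : X) : Prop :=
  if n is m.+1 then exists2 z, walk m x z & adjacent z y else x = y.

Lemma walk_cat m n x y z : walk m x y -> walk n y z -> walk (m + n) x z.
Proof.
move=> xy; elim: n z => [|n IH] z; first by rewrite addn0 => <-.
by rewrite addnS => -[w /IH xw wz]; exists w.
Qed.

Lemma adjacentC x y : adjacent x y -> adjacent y x.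
Proof.
by move=> [p Up [z [[-> ->]|[-> ->]]]]; exists p => //; exists z; [right|left].
Qed.

Lemma walkC n x y : walk n x y -> walk n y x.
Proof.
elim: n x y => [|n IH] x y; first by move=> ->.
move=> [z /IH zx zy]; rewrite -add1n; apply: walk_cat zx.
by exists y => //; exact: adjacentC.
Qed.

(** The length must be the same for all points: this uniformity is what a
single chain of generators provides, and what fails for a suitable pair of
maps. *)
Definition walk_congruence (S : set (X -> X)) : set ((X -> X) * (X -> X)) :=
  [set p | [/\ S p.1, S p.2 & exists n, forall x, walk n (p.1 x) (p.2 x)]].

Lemma walk_congruenceP (S : set (X -> X)) :
  subsemigroup S -> left_congruence S (walk_congruence S).
Proof.
move=> SS; split=> [p []//|a Sa|a b [/= Sa Sb [n ab]]||].
- by split=> //; exists 0%N.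
- by split=> //; exists n => x; exact: walkC.
- move=> a b c [/= Sa _ [m ab]] [/= _ Sc [n bc]]; split=> //.
  by exists (m + n)%N => x; apply: walk_cat (ab x) (bc x).
- move=> s a b Ss [/= Sa Sb [n ab]]; split; [exact: SS|exact: SS|].
  by exists n => x; exact: ab.
Qed.

Lemma smallest_walk_congruence (S : set (X -> X)) :
  subsemigroup S -> U `<=` S `*` S ->
  smallest (left_congruence S) U `<=` walk_congruence S.
Proof.
move=> SS US; apply: smallest_sub; first exact: walk_congruenceP.
move=> [a b] /[dup] Uab /US[/= Sa Sb]; split=> //; exists 1%N => x.
by exists (a x) => //; exists (a, b) => //; exists x; left.
Qed.

(** One more step passes from a set B to the finite union, over the pairs
(a, b), of the sets (B a^-1) b and (B b^-1) a. *)
Lemma walk_gt (S : set (X -> X)) n x :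
  infinite_set [set: X] -> finite_set U -> U `<=` S `*` S -> S `<=` @HX X ->
  ~ ([set: X] #<= [set y | walk n x y]).
Proof.
move=> infX Ufin US SH; elim: n => [|n IH] XB.
  apply: infX; apply: card_le_finite XB _.
  by apply: sub_finite_set (finite_set1 x) => y /= ->.
set B := [set z | walk n x z] in IH.
suff : ~ ([set: X] #<= \bigcup_(p in U)
    (p.2 @` (p.1 @^-1` B) `|` p.1 @` (p.2 @^-1` B))).
  apply; apply: card_le_trans XB _; apply: subset_card_le => y [z Bz [p Up [w]]].
  by case=> -[zE yE]; exists p => //; [left|right]; exists w; rewrite /preimage /= -?zE.
apply: card_gt_bigcup_finite => // p /US[/SH p1H /SH p2H].
apply: card_gtU_infinite => // /card_le_trans /(_ (card_image_le _ _)).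
  exact: HX_preimage_gt.
exact: HX_preimage_gt.
Qed.

End Walks.

(** * The general criterion *)

(** The injection [h] of X * X into X splits part of X into disjoint columns,
indexed by the points [v n], each of size |X|.  Column n + 1 contains both p_n
and q_n: it is too large to be covered by the walks of length n from p_n, and
its disjointness from the other columns makes the p_n, and the q_n, distinct.
Column 0 is kept free so that the complements have size |X|. *)
Lemma not_left_congruence_fg {X : Type} (S : set (X -> X)) :
  infinite_set [set: X] -> subsemigroup S -> S `<=` @HX X ->
  transitive_upto [set: nat] S ->
  ~ left_congruence_fg S (universal_left_congruence S).
Proof.
move=> infX SS SH Str [U [Ufin US UE]].
have [c _] := infinite_setN0 infX.
have [h _ hI] := card_le_fun _ _ c (card_square_leT infX).
have hE x y x' y' : h (x, y) = h (x', y') -> x = x' /\ y = y'.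
  by move=> E; have [] := hI (x, y) (x', y') (conj I I) (conj I I) E.
have [v _ vI] := card_le_fun _ _ c ((infiniteP _).1 infX).
have vE m n : v m = v n -> m = n by apply: vI.
have /choice[y yP] n : exists y, ~ walk U n (h (c, v n.+1)) (h (y, v n.+1)).
  apply/not_existsP => W.
  apply: (walk_gt U S n (h (c, v n.+1)) infX Ufin US SH).
  apply: (card_le_rel _ _ (fun y z => z = h (y, v n.+1))) => [y _|y y' z _ _ ->].
    by exists (h (y, v n.+1)) => //; exact: contrapT (W y).
  by case/hE.
pose p n := h (c, v n.+1); pose q n := h (y n, v n.+1).
pose D := range p.
have qp m n : p m = p n -> q m = q n by move=> /hE[_ /vE[->]].
have qI m n : q m = q n -> p m = p n by move=> /hE[_ /vE[->]].
have /choice[l lP] : forall x, exists z, forall n, x = p n -> z = q n.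
  move=> x; have [[n ->]|Dx] := pselect (exists n, x = p n).
    by exists (q n) => m /qp.
  by exists c => n xE; case: Dx; exists n.
have big (A : set X) : (forall x, A (h (x, v 0))) -> A #= [set: X].
  move=> Ah; apply: Cantor_Bernstein; first exact: card_leT.
  apply: (card_le_rel _ _ (fun x z => z = h (x, v 0))) => [x _|x x' z _ _ ->].
    by exists (h (x, v 0)).
  by case/hE.
have DN : D #<= [set: nat] by exact: card_image_le.
have cD : ~` D #= [set: X] by apply: big => x [n _ /hE[_ /vE]].
have [||a Sa aP] := Str D id _ DN cD; [by []|by rewrite image_id|].
have [||b Sb bP] := Str D l _ DN cD.
- move=> _ _ /set_mem[m _ <-] /set_mem[n _ <-].
  by rewrite (lP _ _ erefl) (lP _ _ erefl) => /qI.
- apply: big => x [_ [n _ <-]]; rewrite (lP _ _ erefl).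
  by move=> /hE[_ /vE].
have [_ _ [n nP]] : walk_congruence U S (a, b).
  by apply: smallest_walk_congruence => //; rewrite UE.
apply: (yP n); have Dp : D (p n) by exists n.
by have := nP (p n); rewrite /= aP// bP// (lP _ _ erefl).
Qed.

(** * Transitivity of the concrete semigroups *)
Lemma card_ltP {T U : Type} (A : set T) (B : set U) :
  card_lt A B <-> ~ (B #<= A).
Proof.
split=> [[AB nAB] BA|BA]; first by apply: nAB; exact: Cantor_Bernstein.
have [AB|//] := card_le_total A B; split=> //.
by move=> /card_eqPle[].
Qed.

Lemma exists_glue {T U : Type} (D : set T) (f g : T -> U) :
  exists2 h : T -> U,
    (forall x, D x -> h x = f x) & (forall x, ~ D x -> h x = g x).
Proof.
by exists (fun x => if pselect (D x) then f x else g x) => x; case: pselect.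
Qed.

(** Inside [E] there are two disjoint copies of [E], the images of two rows of
its square; one receives a copy of [P] and the other bounds what remains from
below. *)
Lemma card_eq_subset_large {T U : Type} (E : set T) (P : set U) :
  infinite_set E -> P #<= E ->
  exists B : set T, [/\ B `<=` E, B #= P & E `\` B #= E].
Proof.
move=> Einf PE; have [e0 Ee0] := infinite_setN0 Einf.
have [e1 [Ee1 e10]] : E `\` [set e0] !=set0.
  exact/infinite_setN0/infinite_setD/finite_set1.
have [f fE fI] := card_le_fun _ _ e0 (card_square_le E Einf).
have [i iE iI] := card_le_fun _ _ e0 PE.
exists ((fun u => f (e0, i u)) @` P); split.
- by move=> _ [u Pu <-]; apply: fE; split=> //; exact: iE.
- apply: inj_card_eq => u v /set_mem Pu /set_mem Pv fuv; apply: iI => //.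
  have Eu := iE _ Pu; have Ev := iE _ Pv.
  by have [] := fI (e0, i u) (e0, i v) (conj Ee0 Eu) (conj Ee0 Ev) fuv.
- apply: Cantor_Bernstein; first by apply: subset_card_le => x [].
  apply: (card_le_rel _ _ (fun x y => y = f (e1, x))) => [x Ex|x y _ Ex Ey ->].
    exists (f (e1, x)) => //; split=> [|[u Pu]]; first exact: fE.
    have Eu := iE _ Pu.
    by move=> /(fI (e0, i u) (e1, x) (conj Ee0 Eu) (conj Ee1 Ex))[e01]; case: e10.
  by move=> /(fI (e1, x) (e1, y) (conj Ee1 Ex) (conj Ee1 Ey))[].
Qed.

(** Let E be the complement of the image of the partial bijection.  Remove from
E a set B of size |P| so that |X| points remain, and map the complement of the
domain bijectively onto E minus B: the extension misses exactly B. *)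
Lemma BLq_transitive {X U V : Type} (P : set U) (K : set V) :
  infinite_set [set: X] -> P #<= [set: X] -> transitive_upto K (@BLq X U P).
Proof.
move=> infX PX D l lI _ DX EX.
have [x0 _] := infinite_setN0 infX.
have [_ XE] := (card_eqPle _ _).1 EX.
have Einf : infinite_set (~` (l @` D)) by rewrite (eq_finite_set EX).
have [B [BE BP CE]] := card_eq_subset_large _ _ Einf (card_le_trans PX XE).
have DC := card_eq_trans DX (card_esym (card_eq_trans CE EX)).
have [g [gC gI gS]] := card_eq_fun _ _ x0 DC.
have [t tD tND] := exists_glue D l g; exists t => //; split.
  move=> x y; have [Dx|Dx] := pselect (D x); have [Dy|Dy] := pselect (D y).
  - by rewrite (tD x)// (tD y)//; apply: lI; exact: mem_set.
  - rewrite (tD x)// (tND y)// => lxgy; have [[]] := gC _ Dy.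
    by rewrite -lxgy; exists x.
  - rewrite (tND x)// (tD y)// => gxly; have [[]] := gC _ Dx.
    by rewrite gxly; exists y.
  - by rewrite (tND x)// (tND y)//; exact: gI.
suff -> : ~` range t = B by [].
apply/seteqP; split=> [y ty|y By [x _]].
  apply: contrapT => nBy; have [|x Dx gxy] := gS y.
    by split=> // -[x Dx lxy]; apply: ty; exists x => //; rewrite tD.
  by apply: ty; exists x => //; rewrite tND.
have [Dx|Dx] := pselect (D x).
  by rewrite tD// => lxy; apply: (BE _ By); exists x.
by rewrite tND// => gxy; have [_] := gC _ Dx; rewrite gxy.
Qed.

(** The complement of the domain is in bijection with X * Q; follow this
bijection by the first projection.  Every fibre then has |Q| points outside
the domain of the partial bijection and at most one point inside it. *)
Lemma DBLq_transitive {X U V : Type} (Q : set U) (K : set V) :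
  infinite_set [set: X] -> infinite_set Q -> Q #<= [set: X] ->
  transitive_upto K (@DBLq X U Q).
Proof.
move=> infX Qinf QX D l lI _ DX _.
have [x0 _] := infinite_setN0 infX; have [u0 Qu0] := infinite_setN0 Qinf.
have XQ : [set: X] `*` Q #= [set: X].
  apply: Cantor_Bernstein; first exact: card_leX_infinite.
  apply: (card_le_rel _ _ (fun x p => p = (x, u0))) => [x _|x y _ _ _ -> []//].
  by exists (x, u0).
have [g [gQ gI gS]] := card_eq_fun _ _ (x0, u0) (card_eq_trans DX (card_esym XQ)).
have [t tD tND] := exists_glue D l (fst \o g); exists t => //; split.
  apply/seteqP; split=> // x _; have [//|z Dz gz] := gS (x, u0).
  by exists z => //; rewrite tND//= gz.
move=> x; apply: Cantor_Bernstein.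
  rewrite -(setUIDK (t @^-1` [set x]) D).
  apply: card_leU_infinite => //.
    apply: (card_le_rel _ _ (fun _ u => u = u0)) => [y _|y z _ [ty Dy] [tz Dz] _ _].
      by exists u0.
    apply: lI; [exact: mem_set|exact: mem_set|].
    by rewrite -(tD y)// -(tD z)// ty tz.
  apply: (card_le_rel _ _ (fun y u => g y = (x, u))) => [y [ty Dy]|].
    exists (g y).2; first by have [] := gQ _ Dy.
    by rewrite -ty tND//= -surjective_pairing.
  move=> y z u [_ Dy] [_ Dz] gy gz; apply: gI => //; by rewrite gy gz.
apply: (card_le_rel _ _ (fun u y => g y = (x, u))) => [u Qu|u v y _ _ -> []//].
have [//|y Dy gy] := gS (x, u); exists y => //.
by rewrite /preimage /= tND//= gy.
Qed.

Lemma transitive_upto_sub {X U : Type} (K : set U) (S S' : set (X -> X)) :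
  S `<=` S' -> transitive_upto K S -> transitive_upto K S'.
Proof.
move=> SS' Str D l lI DK DX EX; have [t St tl] := Str D l lI DK DX EX.
by exists t => //; exact: SS'.
Qed.

Lemma BLq0_SymX {X : Type} : @BLq X X set0 `<=` @SymX X.
Proof.
move=> a [aI]; rewrite card_eq0 => /eqP ra; rewrite /SymX /= -setTT_bijective.
split=> // [x y _ _|y _]; first exact: aI.
by apply: contrapT => ya; have : (~` range a) y by []; rewrite ra.
Qed.

Lemma SymX_transitive {X U : Type} (K : set U) :
  infinite_set [set: X] -> transitive_upto K (@SymX X).
Proof.
move=> infX; apply: transitive_upto_sub BLq0_SymX _.
by apply: BLq_transitive => //; exact: card_ge0.
Qed.

(** * Maps preserving sets of full size *)
Lemma InjX_HX {X : Type} : @InjX X `<=` @HX X.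
Proof.
move=> a aI Y; apply: card_eq_trans; apply: inj_card_eq => x y _ _; exact: aI.
Qed.

Lemma card_preimage_fibres {T U V : Type} (f : T -> U) (B : set U) (K : set V) :
  infinite_set K -> (forall x, B x -> f @^-1` [set x] #<= K) ->
  f @^-1` B #<= B `*` K.
Proof.
move=> Kinf fK; have [k0 _] := infinite_setN0 Kinf.
have /choice[g gP] : forall x, exists g : T -> V, B x ->
    forall y, f y = x -> K (g y) /\ forall z, f z = x -> g y = g z -> y = z.
  move=> x; have [Bx|nBx] := pselect (B x); last by exists (fun _ => k0).
  have [g gK gI] := card_le_fun _ _ k0 (fK _ Bx); exists g => _ y fy.
  by split; [exact: gK|move=> z fz; exact: gI].
apply: (card_le_rel _ _ (fun y p => p = (f y, g (f y) y))) => [y By|].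
  exists (f y, g (f y) y) => //; split=> //=.
  by have [] := gP _ By y erefl.
move=> y z _ By Bz -> [fyz]; rewrite -fyz.
by have [_] := gP _ By y erefl; apply.
Qed.

(** If the image of Y had fewer than |X| points, then Y, being covered by fewer
than |X| fibres of size |Q| < |X|, would too. *)
Lemma DBLq_HX {X U : Type} (Q : set U) :
  infinite_set [set: X] -> infinite_set Q -> card_lt Q [set: X] ->
  @DBLq X U Q `<=` @HX X.
Proof.
move=> infX Qinf /card_ltP QX a [_ aQ] Y YX.
apply: Cantor_Bernstein; first exact: card_leT.
apply: contrapT => aYX; apply: (card_gtX_infinite _ _ _ infX aYX QX).
have [_ XY] := (card_eqPle _ _).1 YX; apply: card_le_trans XY _.
apply: card_le_trans (card_preimage_fibres a _ _ Qinf _).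
  by apply: subset_card_le => y Yy; exists y.
by move=> x _; have [] := (card_eqPle _ _).1 (aQ x).
Qed.

Lemma FX_preimage_finite {X : Type} (a : X -> X) (B : set X) :
  FX a -> finite_set B -> finite_set (a @^-1` B).
Proof.
move=> aF Bfin; apply: sub_finite_set (bigcup_finite Bfin (fun x _ => aF x)).
by move=> y By; exists (a y).
Qed.

(** A set is finite if its image is.  If the image is infinite, the finite
fibres are no larger than it, so the set has at most as many elements as the
square of its image, hence as the image itself. *)
Lemma FX_HX {X : Type} : infinite_set [set: X] -> @FX X `<=` @HX X.
Proof.
move=> infX a aF Y YX; apply: Cantor_Bernstein; first exact: card_leT.
have [_ XY] := (card_eqPle _ _).1 YX; apply: card_le_trans XY _.
have YaY : Y #<= a @^-1` (a @` Y) by apply: subset_card_le => y Yy; exists y.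
have [fin|inf] := pselect (finite_set (a @` Y)).
  have : finite_set Y by apply: card_le_finite YaY _; exact: FX_preimage_finite.
  by rewrite (eq_finite_set YX).
apply: card_le_trans YaY _; apply: card_le_trans (card_square_le _ inf).
apply: card_preimage_fibres => // x _.
by apply: card_le_trans ((infiniteP _).1 inf); exact: finite_set_countable.
Qed.

(** * Closure under composition *)
Lemma range_tmul_sub {X : Type} (a b : X -> X) :
  ~` range (tmul a b) `<=` ~` range b `|` b @` (~` range a).
Proof.
move=> z zab; have [[y _ byz]|] := pselect (range b z); last by left.
by right; exists y => // -[x _ axy]; apply: zab; exists x; rewrite // /tmul /= axy.
Qed.

Lemma range_tmul_ge {X : Type} (a b : X -> X) :
  injective b -> ~` range b `|` b @` (~` range a) `<=` ~` range (tmul a b).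
Proof.
move=> bI z [zb [x _ abx]|[y ya <-] [x _ /bI axy]].
  by apply: zb; exists (a x).
by apply: ya; exists x.
Qed.

Lemma SymX_InjX {X : Type} : @SymX X `<=` @InjX X.
Proof. by move=> a; exact: bij_inj. Qed.

Lemma subsemigroup_BLq {X U : Type} (P : set U) :
  infinite_set P -> subsemigroup (@BLq X U P).
Proof.
move=> Pinf a b [aI aP] [bI bP]; split; first exact: inj_comp.
have [aP1 _] := (card_eqPle _ _).1 aP; have [bP1 bP2] := (card_eqPle _ _).1 bP.
apply: Cantor_Bernstein.
  apply: card_le_trans (subset_card_le (range_tmul_sub a b)) _.
  apply: card_leU_infinite => //; apply: card_le_trans aP1; exact: card_image_le.
apply: card_le_trans bP2 _; apply: subset_card_le.
by apply: subset_trans (range_tmul_ge a b bI) => z zb; left.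
Qed.

(** The points missed by either factor are missed by the product: those of [b]
directly, those of [a] through their images under the injective [b]. *)
Lemma BL_tmul {X : Type} (a b : X -> X) :
  injective a -> injective b -> BL a \/ BL b -> BL (tmul a b).
Proof.
move=> aI bI ab; split; first exact: inj_comp.
apply: Cantor_Bernstein; first exact: card_leT.
apply: card_le_trans (subset_card_le (range_tmul_ge a b bI)).
case: ab => -[_ /card_eqPle[_ X_le]]; apply: card_le_trans X_le _.
  have baE : b @` (~` range a) #= ~` range a by apply: inj_card_eq => x y _ _; exact: bI.
  by rewrite -(card_le_eql baE); apply: subset_card_le => z; right.
by apply: subset_card_le => z; left.
Qed.

Lemma subsemigroup_BL1 {X : Type} : subsemigroup (@BL1 X).
Proof.
move=> a b [aB|->] [bB|->]; [|by left..|by right].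
by left; apply: BL_tmul; [case: aB|case: bB|left].
Qed.

Lemma subsemigroup_SymX {X : Type} : subsemigroup (@SymX X).
Proof. by move=> a b aS bS; exact: bij_comp. Qed.

Lemma subsemigroup_SymX_BL {X : Type} : subsemigroup (@SymX X `|` @BL X).
Proof.
have SI a : (@SymX X `|` @BL X) a -> injective a by case=> [/bij_inj|[]].
move=> a b abS bbS; have aI := SI _ abS; have bI := SI _ bbS.
case: abS => [aS|aB]; last by right; apply: BL_tmul => //; left.
case: bbS => [bS|bB]; last by right; apply: BL_tmul => //; right.
by left; exact: subsemigroup_SymX.
Qed.

Lemma subsemigroup_FX {X : Type} : subsemigroup (@FX X).
Proof. by move=> a b aF bF x; exact: (FX_preimage_finite a _ aF (bF x)). Qed.

Lemma subsemigroup_DBLq {X U : Type} (Q : set U) :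
  infinite_set Q -> subsemigroup (@DBLq X U Q).
Proof.
move=> Qinf a b [aS aQ] [bS bQ]; split.
  apply/seteqP; split=> // x _.
  have [y _ <-] : range b x by rewrite bS.
  have [z _ <-] : range a y by rewrite aS.
  by exists z.
move=> x; apply: Cantor_Bernstein.
  apply: card_le_trans (card_preimage_fibres a (b @^-1` [set x]) Q Qinf _) _.
    by move=> y _; have [] := (card_eqPle _ _).1 (aQ y).
  by apply: card_leX_infinite => //; have [] := (card_eqPle _ _).1 (bQ x).
have [y _ byx] : range b x by rewrite bS.
have [_ Qy] := (card_eqPle _ _).1 (aQ y); apply: card_le_trans Qy _.
by apply: subset_card_le => z azy; rewrite /preimage /tmul /= azy.
Qed.

Lemma subsemigroup_HX {X : Type} : subsemigroup (@HX X).
Proof.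
move=> a b aH bH Y YX; rewrite /tmul -image_comp.
by apply: bH; exact: aH.
Qed.

Lemma subsemigroup_KX {X : Type} :
  infinite_set [set: X] -> subsemigroup (@KX X).
Proof.
move=> infX a b [aH /card_ltP aX] [bH /card_ltP bX].
split; first exact: subsemigroup_HX.
apply/card_ltP => abX.
apply: (@card_gtU_infinite _ _ _ (b @` (~` range a)) _ infX bX).
  by move=> /card_le_trans /(_ (card_image_le _ _)).
exact: card_le_trans abX (subset_card_le (range_tmul_sub a b)).
Qed.

Lemma SymX_KX {X : Type} : infinite_set [set: X] -> @SymX X `<=` @KX X.
Proof.
move=> infX a aS; split; first exact/InjX_HX/SymX_InjX.
have [b _ ab] := aS.
have -> : ~` range a = set0.
  by apply/seteqP; split=> // x; case; exists (b x).
by apply/card_ltP => /card_le0P X0; apply: infX; rewrite X0; exact: finite_set0.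
Qed.

Lemma SymX_FX {X : Type} : @SymX X `<=` @FX X.
Proof.
move=> a [b ab _] x; apply: sub_finite_set (finite_set1 (b x)).
by move=> y <-; rewrite /= ab.
Qed.

(** * Semigroups whose universal left congruence is not finitely generated *)
Theorem theorem4p4 (X : Type) (infX : infinite_set [set: X]) :
  (forall S : set (X -> X),
     subsemigroup S -> S `<=` @HX X -> transitive_upto [set: nat] S ->
     ~ left_congruence_fg S (universal_left_congruence S))
  /\ (subsemigroup (@SymX X) /\
      ~ left_congruence_fg (@SymX X) (universal_left_congruence (@SymX X)))
  /\ (subsemigroup (@FX X) /\
      ~ left_congruence_fg (@FX X) (universal_left_congruence (@FX X)))
  /\ (subsemigroup (@InjX X) /\
      ~ left_congruence_fg (@InjX X) (universal_left_congruence (@InjX X)))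
  /\ (forall (U : Type) (P : set U), infinite_set P -> P #<= [set: X] ->
      subsemigroup (@BLq X U P) /\
      ~ left_congruence_fg (@BLq X U P)
          (universal_left_congruence (@BLq X U P)))
  /\ (subsemigroup (@BL1 X) /\
      ~ left_congruence_fg (@BL1 X) (universal_left_congruence (@BL1 X)))
  /\ (subsemigroup (@SymX X `|` @BL X) /\
      ~ left_congruence_fg (@SymX X `|` @BL X)
          (universal_left_congruence (@SymX X `|` @BL X)))
  /\ (forall (U : Type) (Q : set U), infinite_set Q -> card_lt Q [set: X] ->
      subsemigroup (@DBLq X U Q) /\
      ~ left_congruence_fg (@DBLq X U Q)
          (universal_left_congruence (@DBLq X U Q)))
  /\ (subsemigroup (@HX X) /\
      ~ left_congruence_fg (@HX X) (universal_left_congruence (@HX X)))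
  /\ (subsemigroup (@KX X) /\
      ~ left_congruence_fg (@KX X) (universal_left_congruence (@KX X))).
Proof.
have symN S : subsemigroup S -> S `<=` @HX X -> @SymX X `<=` S ->
    subsemigroup S /\ ~ left_congruence_fg S (universal_left_congruence S).
  move=> SS SH SymS; split=> //; apply: not_left_congruence_fg => //.
  exact: transitive_upto_sub SymS (SymX_transitive _ infX).
have injN S : subsemigroup S -> S `<=` @InjX X -> transitive_upto [set: nat] S ->
    subsemigroup S /\ ~ left_congruence_fg S (universal_left_congruence S).
  move=> SS SI Str; split=> //; apply: not_left_congruence_fg => //.
  exact: subset_trans SI InjX_HX.
split; first by move=> S; exact: not_left_congruence_fg.
split.
  apply: symN => //; first exact: subsemigroup_SymX.
  exact: subset_trans SymX_InjX InjX_HX.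
split; first by apply: symN; [exact: subsemigroup_FX|exact: FX_HX|exact: SymX_FX].
split.
  by apply: symN; [move=> a b aI bI; exact: inj_comp|exact: InjX_HX|exact: SymX_InjX].
split.
  move=> U P Pinf PX; apply: injN; [exact: subsemigroup_BLq|by move=> a []|].
  exact: BLq_transitive.
split.
  apply: injN; [exact: subsemigroup_BL1|by move=> a [[]|->]|].
  apply: (transitive_upto_sub _ (@BL X)); first by left.
  by apply: BLq_transitive.
split.
  apply: symN; [exact: subsemigroup_SymX_BL| |by left].
  by move=> a [/SymX_InjX|[aI _]]; exact: InjX_HX.
split.
  move=> U Q Qinf QX; have QS := @subsemigroup_DBLq X U Q Qinf.
  split=> //; apply: not_left_congruence_fg => //; first exact: DBLq_HX.
  by apply: DBLq_transitive => //; case: QX.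
split.
  by apply: symN; [exact: subsemigroup_HX| |move=> a /(SymX_KX infX)[]].
by apply: symN; [exact: subsemigroup_KX|move=> a []|exact: SymX_KX].
Qed.
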